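(* With the functional $\mathcal E$ defined in the context, $$\mathcal E(u)\ge0\qquad\text{for every }u\in\ell^3(\mathbb Z)\text{ with }u_j\ge0\text{ for all }j\in\mathbb Z.$$ The inequality is strict unless $u=0$.
   Context: Put $q=2^{-1/6}$, $d_0=\pi-2$, $I=4-\pi$, $s(t)=\sqrt{1+t^2}$, and for $t>0$ \begin{align*} A_*(t)&=2t-2s(t)-2\arctan t+\frac{2t}{s(t)+1},\\ B_*(t)&=-2t+2s(t)+\log\frac{t}{s(t)+1}-\frac1{s(t)+1},\\ C_*(t)&=-t^2+ts(t)+\operatorname{arsinh}t-\frac{2t}{s(t)+1}. \end{align*} For $r>1$ let $t_1=(r-1)^{-1/2}$, $t_2=r^{-1/2}$ and $$U(r)=2\{\sqrt r[A_*(t_1)+2]-B_*(t_1)\},\qquad V(r)=2\{\sqrt r\,C_*(t_2)-B_*(t_2)\},$$ $$G_\infty(r)=10-\frac2{\sqrt r}+\frac4{\sqrt r+\sqrt{r-1}}-2I-U(r)-V(r),$$ $$G_{\rm rep}(r)=12-\frac4{\sqrt r}+\frac8{\sqrt r+\sqrt{r-1}}-2(4-\pi)-2U(r).$$ Let $g_0=4\{\pi+\sqrt2-\log(1+\sqrt2)-2\}$ and, for integers $a\ge1$, $g_a=G_\infty(2^a)$, $h_a=G_{\rm rep}(2^a)$. For a nonnegative sequence $u=(u_j)_{j\in\mathbb Z}$ in $\ell^3(\mathbb Z)$ define, by absolutely convergent series, \begin{align*} \mathcal E(u)={}&d_0\sum_iu_i^3+\frac{g_0}2\sum_{i<k}q^{k-i}u_i^2u_k+\frac12\sum_{i<j}h_{j-i}q^{2(j-i)}u_iu_j^2\\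 &+\sum_{i<j<k}g_{j-i}q^{(j-i)+(k-i)}u_iu_ju_k, \end{align*} all indices ranging over $\mathbb Z$. *)

(* Defs.v *)
From mathcomp Require Import all_boot all_order all_algebra.
From mathcomp Require Import all_classical all_reals all_analysis.

Set Implicit Arguments.
Unset Strict Implicit.
Unset Printing Implicit Defensive.

Import Order.TTheory GRing.Theory Num.Theory.
Import numFieldNormedType.Exports.

Local Open Scope classical_set_scope.
Local Open Scope ring_scope.

(* [abs_summable] is absolute convergence of the family [f] over [D];
   [usum] is its sum, meaningful only when [abs_summable D f]. The sum of an
   absolutely convergent signed family is computed, as in the library's [esumB],
   as the difference of the sums of its positive and negative parts. *)
Definition abs_summable {R : realType} {T : choiceType} (D : set T)
    (f : T -> R) : Prop :=
  summable D (EFin \o f).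

Definition usum {R : realType} {T : choiceType} (D : set T) (f : T -> R) : R :=
  fine (\esum_(x in D) (EFin \o f)^\+%E x - \esum_(x in D) (EFin \o f)^\-%E x)%E.

Definition ell3 {R : realType} (u : int -> R) : Prop :=
  abs_summable [set: int] (fun j => `|u j| ^+ 3).

Section Constants.
Context {R : realType}.
Implicit Types t r : R.

Definition q : R := 2 `^ (- (1 / 6)).
Definition d0 : R := pi - 2.
Definition I0 : R := 4 - pi.

Definition s t : R := Num.sqrt (1 + t ^+ 2).
Definition arsinh t : R := ln (t + s t).

Definition Astar t : R := 2 * t - 2 * s t - 2 * atan t + 2 * t / (s t + 1).
Definition Bstar t : R := - 2 * t + 2 * s t + ln (t / (s t + 1)) - 1 / (s t + 1).
Definition Cstar t : R := - t ^+ 2 + t * s t + arsinh t - 2 * t / (s t + 1).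

Definition t1 r : R := (Num.sqrt (r - 1))^-1.
Definition t2 r : R := (Num.sqrt r)^-1.

Definition U r : R := 2 * (Num.sqrt r * (Astar (t1 r) + 2) - Bstar (t1 r)).
Definition V r : R := 2 * (Num.sqrt r * Cstar (t2 r) - Bstar (t2 r)).

Definition Ginf r : R :=
  10 - 2 / Num.sqrt r + 4 / (Num.sqrt r + Num.sqrt (r - 1)) - 2 * I0 - U r - V r.
Definition Grep r : R :=
  12 - 4 / Num.sqrt r + 8 / (Num.sqrt r + Num.sqrt (r - 1)) - 2 * (4 - pi)
  - 2 * U r.

Definition g0 : R := 4 * (pi + Num.sqrt 2 - ln (1 + Num.sqrt 2) - 2).
(* [g] and [h] are only used at indices a >= 1. *)
Definition g (a : nat) : R := Ginf (2 ^+ a).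
Definition h (a : nat) : R := Grep (2 ^+ a).

End Constants.

Section Functional.
Context {R : realType}.
Variable u : int -> R.

Definition pairs : set (int * int) := [set p | p.1 < p.2].
Definition triples : set (int * int * int) := [set p | p.1.1 < p.1.2 < p.2].

Definition cube_term (i : int) : R := u i ^+ 3.

Definition sqleft_term (p : int * int) : R :=
  let: (i, k) := p in q ^ (k - i) * u i ^+ 2 * u k.

Definition sqright_term (p : int * int) : R :=
  let: (i, j) := p in h (absz (j - i)) * q ^ (2 * (j - i)) * u i * u j ^+ 2.

Definition triple_term (p : int * int * int) : R :=
  let: (i, j, k) := p in
  g (absz (j - i)) * q ^ ((j - i) + (k - i)) * u i * u j * u k.

Definition energy_abs_cvg : Prop :=
  [/\ abs_summable [set: int] cube_term,
      abs_summable pairs sqleft_term,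
      abs_summable pairs sqright_term
    & abs_summable triples triple_term].

Definition energy : R :=
  d0 * usum [set: int] cube_term
  + g0 / 2 * usum pairs sqleft_term
  + 1 / 2 * usum pairs sqright_term
  + usum triples triple_term.

End Functional.

(* Main.v *)
Require Import Defs.
From mathcomp Require Import all_boot all_order all_algebra.
From mathcomp Require Import all_classical all_reals all_analysis.
From mathcomp Require Import ring lra zify.

(** Why the theorem holds.

    The coefficients g_a and h_a are positive for small a and tend to minus
    infinity like - 2 ln 2 * a.  Since u is nonnegative, they may be replaced by
    anything smaller, and
      g_a >= m_a,  h_a >= m_a + 2,  m_a = ga - be * a - 4 * 2^(-a/2),
    with ga = 4 + 2 pi - 4 ln 2 and be = 2 ln 2 (lemmas [Ginf_pow2] and
    [Grep_pow2]).  These follow from the closed forms of U and V in terms of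
    x = r^(-1/2): both halves U/2 and V/2 are at most
    -ln x + ln 2 - 1/2 + x.

    The minorant m_a is affine plus a geometric term, so it turns the energy of
    a finite sequence into a sum of costs driven by finitely many linear
    recursions.  Reading the sites from left to right, let
      L_j = sum over i < j of q^(2(j-i)) u_i,
      E_j = the same sum weighted by an extra q^(3(j-i-1)),
      X_j = the same sum weighted by m_(j-i),
      Y_j = sum over k >= j of q^(k-j+1) u_k.
    Then L, E, X at j+1 are linear in L, E, X and u_j, while
    Y_j = q (u_j + Y_(j+1)), and the energy is at least the sum over j of
      d0 u_j^3 + (g0/2) u_j^2 Y_(j+1) + u_j X_j (Y_(j+1) + u_j/2) + L_j u_j^2.
    The identity u_j (Y_(j+1) + u_j/2) = (Y_j^2 / q^2 - Y_(j+1)^2) / 2 shows that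
    the X-part telescopes with potential - X_j Y_j^2 / (2 q^2), after which X no
    longer occurs.  A second, cubic potential in L - E, E
    and Y (the [corrector]) makes every remaining summand at least u_j^3 / 200;
    this is a polynomial inequality in four nonnegative variables
    ([local_inequality]).  The potential vanishes at the right end and is
    nonpositive at the left end, whence energy >= (sum of u_j^3) / 200 for
    finite sequences ([finite_energy_ge]).

    For u in l^3 the sums over the windows [-N, N] are bounded in absolute value
    by a multiple of the sum of u_j^3: the l^3 norms of geometric past and future
    sums are at most a multiple of that of u ([sum_cubes_le_of_recursion]), and
    the growth of g_a, h_a is linear, hence absorbed by q^a.  So all four families are
    summable, the window sums converge to the sums of the families
    ([box_sum_cvg]), and the finite estimate passes to the limit; a single
    nonzero u_j then makes the energy positive. *)

Set Implicit Arguments.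
Unset Strict Implicit.
Unset Printing Implicit Defensive.

Import Order.TTheory GRing.Theory Num.Theory.
Import numFieldNormedType.Exports.

Local Open Scope classical_set_scope.
Local Open Scope ring_scope.

(** Decimals in groups of two digits: [dec4 113 60] is 1.1360 and
    [dec6 89 08 98] is 0.890898.  Grouping keeps each numeral small. *)
Local Notation dec4 a b := ((a + b / 100) / 100).
Local Notation dec6 a b c := ((a + (b + c / 100) / 100) / 100).

(** * Elementary inequalities and numerical constants *)

Section Elementary.
Context {R : realType}.
Implicit Types x y t w : R.

Lemma sin_le_id x : 0 <= x -> sin x <= x.
Proof.
rewrite le_eqVlt => /predU1P[<-|x0]; first by rewrite sin0.
have [z _ e] : exists2 z, z \in `[0, x]%R & sin x - sin 0 = cos z * (x - 0).
  apply: MVT_segment => //; first exact: ltW.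
  by apply: continuous_subspaceT => ?; exact: continuous_sin.
move: e; rewrite sin0 !subr0 => ->.
by rewrite ger_pMl // cos_le1.
Qed.

Lemma cos_ge_quadratic x : 0 <= x -> 1 - x ^+ 2 / 2 <= cos x.
Proof.
move=> x0.
have -> : cos x = 1 - 2 * sin (x / 2) ^+ 2.
  have -> : x = (x / 2) *+ 2 by lra.
  rewrite cos_mulr2n cos2sin2; have -> : x / 2 *+ 2 / 2 = x / 2 by lra.
  lra.
have [xpi|] := lerP (x / 2) pi.
  have s0 : 0 <= sin (x / 2) by apply: sin_ge0_pi; rewrite xpi andbT; lra.
  have sx : sin (x / 2) <= x / 2 by apply: sin_le_id; lra.
  nra.
move=> xpi; have p2 := @pi_ge2 R.
have := sin_le1 (x / 2); have := sin_geN1 (x / 2). nra.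
Qed.

Lemma expR_ge_cubic t : 0 <= t -> 1 + t + t ^+ 2 / 2 + t ^+ 3 / 6 <= expR t.
Proof.
move=> t0.
have -> : 1 + t + t ^+ 2 / 2 + t ^+ 3 / 6 = series (exp_coeff t) 4.
  rewrite /series /= !big_nat_recr //= big_geq // /exp_coeff /=.
  by rewrite expr0 !factS fact0; field.
apply: (@nondecreasing_cvgn_le R (series (exp_coeff t))); last first.
  exact: is_cvg_series_exp_coeff.
by apply: nondecreasing_series => n _ _; rewrite /exp_coeff /= divr_ge0 ?exprn_ge0.
Qed.

(** This is t <= sinh t for t = ln w.  It follows from
    (1 + t + t^2/2) (1 - t + t^2/2) = 1 + t^4/4 >= 1, which bounds 1/w. *)
Lemma ln_le_half_diff w : 1 <= w -> ln w <= (w - w^-1) / 2.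
Proof.
move=> w1; have t0 := ln_ge0 w1.
have wE : expR (ln w) = w by rewrite lnK // posrE; lra.
have := expR_ge_cubic t0; rewrite wE; set t := ln w => tw.
have w0 : 0 < w by lra.
have t3 : 0 <= t ^+ 3 by rewrite exprn_ge0.
have {}tw : 1 + t + t ^+ 2 / 2 <= w by lra.
have : w^-1 <= 1 - t + t ^+ 2 / 2.
  rewrite -div1r ler_pdivrMr //.
  have a0 : 0 <= 1 - t + t ^+ 2 / 2 by nra.
  apply: (@le_trans _ _ ((1 - t + t ^+ 2 / 2) * (1 + t + t ^+ 2 / 2)));
    last by rewrite ler_wpM2l.
  nra.
lra.
Qed.

(** Taylor's polynomial is accurate enough at a quarter of the logarithm. *)
Lemma ln_le_of_fourth_power a w : 0 <= a -> 0 < w ->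
  w <= (1 + a + a ^+ 2 / 2 + a ^+ 3 / 6) ^+ 4 -> ln w <= 4 * a.
Proof.
move=> a0 w0 wa; rewrite -ler_expR lnK ?posrE // expRM_natl.
rewrite (le_trans wa) // lerXn2r ?nnegrE ?expR_ge0 ?expR_ge_cubic //.
by rewrite !addr_ge0 ?mulr_ge0 ?exprn_ge0.
Qed.

(** Two squarings with a rounding in between. *)
Lemma fourth_power_ge (x a b c : R) : 0 <= a -> 0 <= b ->
  a <= x -> b <= a ^+ 2 -> c <= b ^+ 2 -> c <= x ^+ 4.
Proof.
move=> a0 b0 ax ba cb; apply: (le_trans cb); rewrite (exprM x 2 2).
have x0 : 0 <= x by exact: le_trans ax.
apply: lerXn2r; rewrite ?nnegrE ?exprn_ge0 //; apply: (le_trans ba).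
exact: lerXn2r.
Qed.

Lemma ln2_le : ln 2 <= dec4 69 40 :> R.
Proof.
have -> : dec4 69 40 = 4 * (dec4 17 35) :> R by field.
apply: ln_le_of_fourth_power; [lra|lra|].
by apply: (@fourth_power_ge _ (dec4 118 93) (dec4 141 43)); lra.
Qed.

Lemma sqrt2_bounds : dec4 141 42 <= (Num.sqrt 2 : R) <= dec4 141 43.
Proof.
by apply/andP; split;
  rewrite -(@ler_pXn2r _ 2) ?nnegrE ?sqrtr_ge0 ?sqr_sqrtr //; lra.
Qed.

Lemma ln_silver_le : ln (1 + Num.sqrt 2) <= dec4 88 40 :> R.
Proof.
have /andP[_ s2] := sqrt2_bounds.
have -> : dec4 88 40 = 4 * (dec4 22 10) :> R by field.
apply: ln_le_of_fourth_power; [lra|by rewrite ltr_pwDl ?sqrtr_ge0|].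
apply: (@fourth_power_ge _ (dec4 124 70) (dec4 155 50)); try by clear; lra.
by clear -s2; lra.
Qed.

(** Archimedes: half-angle formulas bound cos (pi/16) from above, and
    cos t >= 1 - t^2/2 turns this into a lower bound for pi. *)
Lemma pi_lower_bound : dec4 313 60 <= pi :> R.
Proof.
have pi0 := @pi_gt0 R.
pose c k := cos (pi / 2 ^+ k : R).
have cS k : (c k.+1) ^+ 2 = (1 + c k) / 2.
  rewrite /c; set z := pi / 2 ^+ k.+1.
  have -> : pi / 2 ^+ k = z *+ 2 by rewrite /z exprS; field; rewrite expf_neq0.
  by rewrite cos_mulr2n; field.
have c1 : c 1%N = 0 by rewrite /c expr1 cos_pihalf.
have up k (a b : R) : 0 <= b -> c k <= a -> (1 + a) / 2 <= b ^+ 2 -> c k.+1 <= b.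
  move=> b0 ca ab; rewrite leNgt; apply/negP => bc.
  have : b ^+ 2 < c k.+1 ^+ 2 by rewrite ltrXn2r // ltW // (le_lt_trans b0).
  have := cS k.
  lra.
have c2 : c 2%N <= dec6 70 71 20 by apply: (up _ 0); [lra|rewrite c1|lra].
have c3 : c 3%N <= dec6 92 38 90 by apply: (up _ _ _ _ c2); lra.
have c4 : c 4%N <= dec6 98 07 90 by apply: (up _ _ _ _ c3); lra.
have pi16 : 0 <= pi / 2 ^+ 4 :> R by rewrite divr_ge0 ?exprn_ge0 // ltW.
have := cos_ge_quadratic pi16; rewrite -/(c 4%N) => h.
rewrite leNgt; apply/negP => hpi.
have : pi ^+ 2 < (dec4 313 60) ^+ 2 :> R by rewrite ltrXn2r ?nnegrE // ltW.
lra.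
Qed.

End Elementary.

(** * Lower bounds for the coefficients of the energy *)

Section Coefficients.
Context {R : realType}.
Implicit Types x y : R.

Lemma q_gt0 : 0 < q :> R.
Proof. by rewrite /q powR_gt0. Qed.

Lemma q_pow6 : q ^+ 6 = 1 / 2 :> R.
Proof.
rewrite /q -powR_mulrn ?powR_ge0 // -powRrM.
have -> : - (1 / 6) * 6%:R = - 1 :> R by field.
by rewrite powR_inv1 // div1r.
Qed.

Lemma sqrt_inv_sqr x : 0 < x -> Num.sqrt (x ^- 2) = x^-1.
Proof. by move=> x0; rewrite -exprVn sqrtr_sqr ger0_norm // invr_ge0 ltW. Qed.

Lemma sqrt_inv_sqr_sub1 x y : 0 < x -> 0 < y -> x ^+ 2 + y ^+ 2 = 1 ->
  Num.sqrt (x ^- 2 - 1) = y / x.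
Proof.
move=> x0 y0 xy.
have -> : x ^- 2 - 1 = (y / x) ^+ 2.
  rewrite expr_div_n; have -> : y ^+ 2 = 1 - x ^+ 2 by lra.
  by rewrite mulrBl mul1r divff // expf_neq0 // lt0r_neq0.
by rewrite sqrtr_sqr ger0_norm // divr_ge0 // ltW.
Qed.

Lemma s_ratio x y : 0 < y -> x ^+ 2 + y ^+ 2 = 1 -> s (x / y) = y^-1.
Proof.
move=> y0 xy; rewrite /s.
have -> : 1 + (x / y) ^+ 2 = y ^- 2.
  rewrite expr_div_n; have -> : x ^+ 2 = 1 - y ^+ 2 by lra.
  by rewrite mulrBl mul1r divff ?expf_neq0 ?lt0r_neq0 // addrC subrK.
exact: sqrt_inv_sqr.
Qed.

(** With r = x^-2 and y = sqrt (1 - x^2), the parameter of U is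
    t1 = x / y and s t1 = 1 / y. *)
Lemma U_closed_form x y : 0 < x -> 0 < y -> x ^+ 2 + y ^+ 2 = 1 ->
  U (x ^- 2) =
    2 * (ln (1 + y) - ln x + 1 + (1 + 2 * x) / (1 + y) - 2 * (atan (x / y) / x)).
Proof.
move=> x0 y0 xy; rewrite /U /t1 sqrt_inv_sqr // (sqrt_inv_sqr_sub1 x0 y0) //.
rewrite invf_div /Astar /Bstar s_ratio //.
have y1 : 0 < 1 + y by lra.
have -> : x / y / (y^-1 + 1) = x / (1 + y) by field; rewrite !lt0r_neq0.
rewrite ln_div ?posrE //.
set th := atan _; set lx := ln x; set ly := ln (1 + y).
apply/eqP; rewrite -subr_eq0; apply/eqP.
(* The two sides agree only on the circle x^2 + y^2 = 1. *)
transitivity (4 * (x ^+ 2 + y ^+ 2 - 1) / (x * y * (1 + y))).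
  by field; rewrite !lt0r_neq0.
by rewrite xy subrr mulr0 mul0r.
Qed.

Lemma V_closed_form x : 0 < x ->
  V (x ^- 2) =
    2 * (x - s x + arsinh x / x - 1 / (s x + 1) - ln x + ln (s x + 1)).
Proof.
move=> x0; rewrite /V /t2 sqrt_inv_sqr // !invrK /Cstar /Bstar.
have s1 : 0 < s x + 1 by rewrite ltr_wpDl // sqrtr_ge0.
by rewrite ln_div ?posrE //; field; rewrite !lt0r_neq0.
Qed.

Lemma s_ge1 x : 1 <= s x.
Proof. by rewrite /s -[leLHS]sqrtr1 ler_wsqrtr // lerDl sqr_ge0. Qed.

Lemma s_sqr x : s x ^+ 2 = 1 + x ^+ 2.
Proof. by rewrite /s sqr_sqrtr // addr_ge0 // sqr_ge0. Qed.

(** The inverse of x + s x is s x - x, so this is [ln_le_half_diff]. *)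
Lemma arsinh_le_id x : 0 <= x -> arsinh x <= x.
Proof.
move=> x0; rewrite /arsinh; have s1 := s_ge1 x.
have w0 : 0 < x + s x by lra.
have inv : (x + s x)^-1 = s x - x.
  apply: (mulfI (lt0r_neq0 w0)); rewrite divff ?lt0r_neq0 //.
  by have := s_sqr x; nra.
have := @ln_le_half_diff R (x + s x) ltac:(lra).
by rewrite inv; lra.
Qed.

(** With S = s x, the inequality arsinh x <= x and the tangent lines at S = 1 of
    ln (S + 1) and 1 / (S + 1) leave a term - (S - 1) / 4, which is dropped. *)
Lemma V_upper_bound x : 0 < x ->
  V (x ^- 2) <= 2 * (ln 2 - ln x - 1 / 2 + x).
Proof.
move=> x0; rewrite V_closed_form // ler_pM2l //.
have s1 := s_ge1 x; set S := s x in s1 *.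
have ash : arsinh x / x <= 1 by rewrite ler_pdivrMr // mul1r arsinh_le_id // ltW.
have lS : ln (S + 1) <= ln 2 + (S - 1) / 2.
  have -> : S + 1 = 2 * (1 + (S - 1) / 2) by field.
  by rewrite lnM ?posrE ?lerD2l ?le_ln1Dx //; lra.
have iS : 1 / 2 - (S - 1) / 4 <= 1 / (S + 1).
  rewrite ler_pdivlMr; nra.
lra.
Qed.

(** The angle th = atan (x/y) has cosine y, so th^2 >= 2 (1 - y); the right
    side dominates x^2 (1 + (1-y)/4)^2 because x^2 = (1-y)(1+y). *)
Lemma atan_ratio_ge x y : 0 < x -> 0 < y -> x ^+ 2 + y ^+ 2 = 1 ->
  x * (1 + (1 - y) / 4) <= atan (x / y).
Proof.
move=> x0 y0 xy; set th := atan _.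
have th0 : 0 <= th by rewrite /th -atan0 le_atan // divr_ge0 // ltW.
have cth : cos th = y.
  rewrite /th cos_atan; have := s_ratio y0 xy; rewrite /s => ->.
  by rewrite invrK.
have := cos_ge_quadratic th0; rewrite cth => yth.
have y1 : y <= 1 by nra.
rewrite -(@ler_pXn2r _ 2) ?nnegrE //; last by rewrite mulr_ge0 ?ltW //; lra.
apply: (@le_trans _ _ (2 * (1 - y))); last by lra.
rewrite exprMn; have -> : x ^+ 2 = (1 - y) * (1 + y) by lra.
rewrite -mulrA mulrC ler_wpM2r ?subr_ge0 // -subr_ge0.
have -> : 2 - (1 + y) * (1 + (1 - y) / 4) ^+ 2 =
    3 / 8 * (1 - y) ^+ 2 + (1 - y) ^+ 3 / 16 by field.
by rewrite addr_ge0 ?mulr_ge0 ?exprn_ge0 ?subr_ge0.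
Qed.

(** The same bound as for V: the gain (1-y)/2 from [atan_ratio_ge] and the one
    from ln (1 + y) pay for (1 + 2x) / (1 + y) as soon as x <= y, that is for
    r >= 2. *)
Lemma U_upper_bound x y : 0 < x -> x <= y -> x ^+ 2 + y ^+ 2 = 1 ->
  U (x ^- 2) <= 2 * (ln 2 - ln x - 1 / 2 + x).
Proof.
move=> x0 xley xy; have y0 : 0 < y by lra.
have y1 : y <= 1 by nra.
rewrite (U_closed_form x0 y0 xy) ler_pM2l //.
have th : 1 + (1 - y) / 4 <= atan (x / y) / x.
  by rewrite ler_pdivlMr // mulrC atan_ratio_ge.
have ly : ln (1 + y) <= ln 2 - (1 - y) / 2.
  have -> : 1 + y = 2 * (1 + (- ((1 - y) / 2))) by field.
  by rewrite lnM ?posrE ?lerD2l ?le_ln1Dx //; lra.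
have iy : (1 + 2 * x) / (1 + y) <= 1 / 2 + x + (1 - y).
  rewrite ler_pdivrMr; nra.
lra.
Qed.

Lemma U_lower_bound x y : 0 < x -> x <= 1 -> 1 / 2 <= y -> x ^+ 2 + y ^+ 2 = 1 ->
  - 8 <= U (x ^- 2).
Proof.
move=> x0 x1 y2 xy; have y0 : 0 < y by lra.
rewrite (U_closed_form x0 y0 xy).
have lx : ln x <= 0 by rewrite ln_le0.
have ly : 0 <= ln (1 + y) by rewrite ln_ge0 //; lra.
have iy : 0 <= (1 + 2 * x) / (1 + y) by rewrite divr_ge0 //; lra.
have th : atan (x / y) / x <= 2.
  rewrite ler_pdivrMr //.
  have xy2 : x / y <= 2 * x by rewrite ler_pdivrMr //; nra.
  apply: le_trans xy2.
  have t0 : 0 <= x / y by rewrite divr_ge0 ?ltW.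
  have a0 : 0 <= atan (x / y) by rewrite -atan0 le_atan.
  have [z _ e] : exists2 z, z \in `[0, x / y]%R &
      atan (x / y) - atan 0 = (1 + z ^+ 2)^-1 * (x / y - 0).
    apply: MVT_segment => //.
    by apply: continuous_subspaceT => ?; exact: continuous_atan.
  move: e; rewrite atan0 !subr0 => ->.
  by rewrite ger_pMl ?divr_gt0 // invf_le1 ?lerDl ?sqr_ge0 // ltr_pwDl // sqr_ge0.
lra.
Qed.

Lemma V_lower_bound x : 0 < x -> x <= 1 -> - 6 <= V (x ^- 2).
Proof.
move=> x0 x1; rewrite V_closed_form //.
have s1 := s_ge1 x; have s2 := s_sqr x.
have s3 : s x <= 2 by nra.
have lx : ln x <= 0 by rewrite ln_le0.
have lS : 0 <= ln (s x + 1) by rewrite ln_ge0 //; lra.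
have ash : 0 <= arsinh x / x.
  by apply: divr_ge0; [rewrite /arsinh ln_ge0 //; lra|exact: ltW].
have iS : 1 / (s x + 1) <= 1 by rewrite ler_pdivrMr; lra.
lra.
Qed.

(** For r = 2^a the parameter x = r^(-1/2) is q^(3a), since q^3 = 2^(-1/2). *)
Lemma pow2_param (a : nat) (x := q ^+ (3 * a) : R) (y := Num.sqrt (1 - x ^+ 2)) :
  (0 < a)%N ->
  [/\ 2 ^+ a = x ^- 2, 0 < x, x <= y, 1 / 2 <= y & x ^+ 2 + y ^+ 2 = 1] /\
  [/\ x <= 1 & ln x = - (a%:R * ln 2 / 2)].
Proof.
move=> a0; have x0 : 0 < x by rewrite /x exprn_gt0 // q_gt0.
have x2 : x ^+ 2 = (1 / 2) ^+ a.
  by rewrite /x -exprM -q_pow6 -exprM; congr (_ ^+ _); lia.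
have x2le : x ^+ 2 <= 1 / 2.
  by rewrite x2 -[leRHS]expr1 ler_wiXn2l //; lra.
have y2 : y ^+ 2 = 1 - x ^+ 2 by rewrite /y sqr_sqrtr //; lra.
have y0 : 0 <= y by rewrite sqrtr_ge0.
have r2 : 2 ^+ a = x ^- 2 by rewrite x2 div1r exprVn invrK.
do 2!split => //; try by nra.
have : ln (x ^- 2) = a%:R * ln 2 by rewrite -r2 lnXn // mulr_natl.
have x20 : 0 < x ^+ 2 by exact: exprn_gt0.
by rewrite lnV ?posrE // lnXn // => lx; lra.
Qed.

Definition minorant (a : nat) : R :=
  4 + 2 * pi - 4 * ln 2 - 2 * ln 2 * a%:R - 4 * q ^+ (3 * a).

(** The lower bound compensates the term - 2 / sqrt r of G_infty, and twice it
    the term - 4 / sqrt r of G_rep. *)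
Lemma gap_term_bounds x y : 0 < x -> 0 < y -> y <= 1 ->
  2 * x <= 4 / (x^-1 + y / x) <= 4 * x.
Proof.
move=> x0 y0 y1; have -> : 4 / (x^-1 + y / x) = 4 * x / (1 + y).
  have y10 : 0 < 1 + y by lra.
  by field; rewrite !lt0r_neq0.
by apply/andP; split; [rewrite ler_pdivlMr|rewrite ler_pdivrMr]; nra.
Qed.

Lemma Ginf_pow2 (a : nat) : (0 < a)%N -> minorant a <= (g a : R) <= 26.
Proof.
move=> a0; have [[r2 x0 xy y2 xy1] [x1 lx]] := pow2_param a0.
rewrite /g /Ginf r2.
have y0 : 0 < Num.sqrt (1 - (q ^+ (3 * a)) ^+ 2) :> R by lra.
rewrite sqrt_inv_sqr // (sqrt_inv_sqr_sub1 x0 y0) //.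
have y1 : Num.sqrt (1 - (q ^+ (3 * a)) ^+ 2) <= 1 :> R by nra.
have /andP[g1 g2] := gap_term_bounds x0 y0 y1.
have := U_upper_bound x0 xy xy1; have := U_lower_bound x0 x1 y2 xy1.
have := V_upper_bound x0; have := V_lower_bound x0 x1.
rewrite /minorant /I0 invrK lx.
have p4 : pi <= 4 :> R by have := @pihalf_lt2 R; lra.
move: (U _) (V _) (4 / (_ + _)) g1 g2 => u v w g1 g2 ? ? ? ?.
by apply/andP; split; lra.
Qed.

Lemma Grep_pow2 (a : nat) : (0 < a)%N -> minorant a + 2 <= (h a : R) <= 36.
Proof.
move=> a0; have [[r2 x0 xy y2 xy1] [x1 lx]] := pow2_param a0.
rewrite /h /Grep r2.
have y0 : 0 < Num.sqrt (1 - (q ^+ (3 * a)) ^+ 2) :> R by lra.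
rewrite sqrt_inv_sqr // (sqrt_inv_sqr_sub1 x0 y0) //.
have y1 : Num.sqrt (1 - (q ^+ (3 * a)) ^+ 2) <= 1 :> R by nra.
have /andP[g1 g2] := gap_term_bounds x0 y0 y1.
have := U_upper_bound x0 xy xy1; have := U_lower_bound x0 x1 y2 xy1.
rewrite /minorant invrK lx.
have p4 : pi <= 4 :> R by have := @pihalf_lt2 R; lra.
have -> z : 8 / z = 2 * (4 / z) :> R by rewrite mulrA -natrM.
move: (U _) (4 / (_ + _)) g1 g2 => u w g1 g2 ? ?.
by apply/andP; split; lra.
Qed.

Lemma q_le : q <= 9 / 10 :> R.
Proof.
rewrite leNgt; apply/negP => hq.
have : (9 / 10) ^+ 6 < q ^+ 6 :> R by rewrite ltrXn2r ?nnegrE // ltW // q_gt0.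
by rewrite q_pow6; lra.
Qed.

(** One step multiplies by q (a+10)/(a+9), at most 1 because q <= 9/10. *)
Lemma linear_mul_pow_le (a : nat) : (a%:R + 9) * q ^+ a <= 9 :> R.
Proof.
elim: a => [|a IH]; first by rewrite expr0; lra.
apply: le_trans IH; rewrite exprS mulrA ler_wpM2r ?exprn_ge0 ?(ltW q_gt0) //.
have a0 : 0 <= a%:R :> R by [].
by have := q_le; have := @q_gt0; rewrite -natr1; nra.
Qed.

Lemma minorant_ge (a : nat) : - (2 * a%:R) <= minorant a.
Proof.
have a0 : 0 <= a%:R :> R by [].
have q1 : q ^+ (3 * a) <= 1 :> R.
  by rewrite exprn_ile1 ?(ltW q_gt0) //; have := q_le; lra.
have l2 := @ln2_le R; have p3 := @pi_ge2 R; rewrite /minorant; nra.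
Qed.

(** Linear growth is absorbed by one factor q^a, half of the decay available
    in the energy; the other half makes the series converge. *)
Lemma coefficients_growth (a : nat) : (0 < a)%N ->
  `|g a : R| * q ^+ a <= 60 /\ `|h a : R| * q ^+ a <= 60.
Proof.
move=> a0; have /andP[g1 g2] := Ginf_pow2 a0; have /andP[h1 h2] := Grep_pow2 a0.
have gm := minorant_ge a; have lin := linear_mul_pow_le a.
have n0 : 0 <= a%:R :> R by [].
have qa0 : 0 < q ^+ a :> R by rewrite exprn_gt0 // q_gt0.
have qa1 : q ^+ a <= 1 :> R.
  by rewrite exprn_ile1 ?(ltW q_gt0) //; have := q_le; lra.
have key z : - (2 * a%:R) <= z -> z <= 36 -> `|z| * q ^+ a <= 60 :> R.
  move=> z1 z2; apply: (@le_trans _ _ ((36 + 2 * a%:R) * q ^+ a)); last by nra.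
  by rewrite ler_pM2r // ler_norml; apply/andP; split; lra.
by split; apply: key; lra.
Qed.

Lemma d0_ge : dec4 113 60 <= d0 :> R.
Proof. by have := @pi_lower_bound R; rewrite /d0; lra. Qed.

Lemma g0_ge : dec4 666 40 <= g0 :> R.
Proof.
have := @pi_lower_bound R; have := @ln_silver_le R; have /andP[] := @sqrt2_bounds R.
by rewrite /g0; lra.
Qed.

Lemma offset_ge : dec4 749 60 <= 4 + 2 * pi - 4 * ln 2 :> R.
Proof. by have := @pi_lower_bound R; have := @ln2_le R; lra. Qed.

Lemma slope_le : 2 * ln 2 <= dec4 138 80 :> R.
Proof. by have := @ln2_le R; lra. Qed.

End Coefficients.

(** * The local cubic inequality *)

(** The cubic part of the potential.  The conditions that it must satisfy are
    linear in its six coefficients; these values solve the resulting linear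
    program with room for rounding. *)
Definition corrector (R : realFieldType) (f e y : R) : R :=
  (745 / 100 * f ^+ 2 + 23 / 10 * f * e + 335 / 100 * e ^+ 2) * y
  + (52 / 100 * e - 94 / 100 * f) * y ^+ 2 - 34 / 100 * y ^+ 3.

Lemma root_power_bounds (R : realFieldType) (q : R) : 0 <= q -> q ^+ 6 = 1 / 2 ->
  [/\ dec6 89 08 90 <= q <= dec6 89 09 00,
      dec6 79 36 90 <= q ^+ 2 <= dec6 79 37 20,
      dec6 70 70 80 <= q ^+ 3 <= dec6 70 71 30,
      dec6 62 99 20 <= q ^+ 4 <= dec6 63 00 10 &
   [/\ dec6 56 11 80 <= q ^+ 5 <= dec6 56 12 90,
      dec6 44 53 60 <= q ^+ 7 <= dec6 44 55 30 &
      dec6 31 48 60 <= q ^+ 10 <= dec6 31 51 10]].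
Proof.
move=> q0 q6.
have lo : dec6 89 08 98 <= q.
  by rewrite -(@ler_pXn2r _ 6) ?nnegrE ?q6 //; lra.
have hi : q <= dec6 89 08 99.
  by rewrite -(@ler_pXn2r _ 6) ?nnegrE ?q6 //; lra.
clear q6.
have mulX i j (a b c : R) : 0 <= a -> 0 <= b -> c <= a * b ->
    a <= q ^+ i -> b <= q ^+ j -> c <= q ^+ (i + j).
  by move=> a0 b0 ab ai bj; rewrite exprD (le_trans ab) // ler_pM.
have mulX' i j (a b c : R) : a * b <= c ->
    q ^+ i <= a -> q ^+ j <= b -> q ^+ (i + j) <= c.
  by move=> ab ai bj; rewrite exprD (le_trans _ ab) // ler_pM // exprn_ge0.
have lo2 : dec6 79 36 90 <= q ^+ 2.
  by apply: (mulX 1%N 1%N _ _ _ _ _ _ lo lo); clear; lra.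
have hi2 : q ^+ 2 <= dec6 79 37 20.
  by apply: (mulX' 1%N 1%N _ _ _ _ hi hi); clear; lra.
have lo3 : dec6 70 70 80 <= q ^+ 3.
  by apply: (mulX 1%N 2%N _ _ _ _ _ _ lo lo2); clear; lra.
have hi3 : q ^+ 3 <= dec6 70 71 30.
  by apply: (mulX' 1%N 2%N _ _ _ _ hi hi2); clear; lra.
have lo4 : dec6 62 99 20 <= q ^+ 4.
  by apply: (mulX 2%N 2%N _ _ _ _ _ _ lo2 lo2); clear; lra.
have hi4 : q ^+ 4 <= dec6 63 00 10.
  by apply: (mulX' 2%N 2%N _ _ _ _ hi2 hi2); clear; lra.
have lo5 : dec6 56 11 80 <= q ^+ 5.
  by apply: (mulX 2%N 3%N _ _ _ _ _ _ lo2 lo3); clear; lra.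
have hi5 : q ^+ 5 <= dec6 56 12 90.
  by apply: (mulX' 2%N 3%N _ _ _ _ hi2 hi3); clear; lra.
have lo7 : dec6 44 53 60 <= q ^+ 7.
  by apply: (mulX 3%N 4%N _ _ _ _ _ _ lo3 lo4); clear; lra.
have hi7 : q ^+ 7 <= dec6 44 55 30.
  by apply: (mulX' 3%N 4%N _ _ _ _ hi3 hi4); clear; lra.
have lo10 : dec6 31 48 60 <= q ^+ 10.
  by apply: (mulX 5%N 5%N _ _ _ _ _ _ lo5 lo5); clear; lra.
have hi10 : q ^+ 10 <= dec6 31 51 10.
  by apply: (mulX' 5%N 5%N _ _ _ _ hi5 hi5); clear; lra.
have lo1 : dec6 89 08 90 <= q by clear -lo; lra.
have hi1 : q <= dec6 89 09 00 by clear -hi; lra.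
by rewrite lo1 hi1 lo2 hi2 lo3 hi3 lo4 hi4 lo5 hi5 lo7 hi7 lo10 hi10.
Qed.

(** The negative coefficients are absorbed by squares such as c (f - 0.28 c)^2;
    the difference of the two sides is a combination with nonnegative
    coefficients of the products s0 to s7 and of monomials. *)
Lemma rational_cubic_ge (R : realFieldType) (f e b c : R) :
  0 <= f -> 0 <= e -> 0 <= b -> 0 <= c ->
  b ^+ 3 / 200 <=
    dec4 9 95 * (c ^+ 3) +
    dec4 50 57 * (b * c ^+ 2) +
    dec4 50 01 * (b ^+ 2 * c) +
    dec4 89 55 * (b ^+ 3) +
    dec4 5 94 * (e * c ^+ 2) +
    - dec4 258 40 * (e * b * c) +
    dec4 141 27 * (e * b ^+ 2) +
    dec4 122 40 * (e ^+ 2 * c) +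
    dec4 298 44 * (e ^+ 2 * b) +
    - dec4 69 41 * (f * c ^+ 2) +
    - dec4 294 13 * (f * b * c) +
    dec4 25 39 * (f * b ^+ 2) +
    - dec4 172 66 * (f * e * c) +
    dec4 204 90 * (f * e * b) +
    dec4 194 35 * (f ^+ 2 * c) +
    dec4 663 71 * (f ^+ 2 * b).
Proof.
move=> f0 e0 b0 c0.
have p3 x y z : 0 <= x -> 0 <= y -> 0 <= z -> 0 <= x * y * z :> R.
  by move=> ? ? ?; rewrite !mulr_ge0.
have sq x y z : 0 <= x -> 0 <= x * (y - z) ^+ 2 :> R.
  by move=> ?; rewrite mulr_ge0 // sqr_ge0.
have s0 := sq _ f (28 / 100 * c) c0.
have s1 := sq _ f (125 / 100 * e) c0.
have s2 := sq _ e (18 / 10 * b) c0.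
have s3 := sq _ f (22 / 100 * c) b0.
have s4 := sq _ e (25 / 100 * c) b0.
have s5 := sq _ e (16 / 10 * b) b0.
have s6 := sq _ b (15 / 100 * c) e0.
have s7 := sq _ b (1 / 10 * c) f0.
have m0 := p3 _ _ _ f0 e0 b0.
have m1 := p3 _ _ _ b0 b0 b0.
have m2 := p3 _ _ _ b0 b0 c0.
have m3 := p3 _ _ _ b0 c0 c0.
have m4 := p3 _ _ _ f0 f0 f0.
have m5 := p3 _ _ _ e0 e0 e0.
have m6 := p3 _ _ _ c0 c0 c0.
have m7 := p3 _ _ _ e0 e0 c0.
have m8 := p3 _ _ _ f0 f0 c0.
have m9 := p3 _ _ _ f0 e0 c0.
have m10 := p3 _ _ _ f0 c0 c0.
have m11 := p3 _ _ _ e0 c0 c0.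
have m12 := p3 _ _ _ f0 b0 b0.
have m13 := p3 _ _ _ e0 b0 b0.
have m14 := p3 _ _ _ f0 f0 b0.
have m15 := p3 _ _ _ e0 e0 b0.
have m16 := p3 _ _ _ f0 b0 c0.
have m17 := p3 _ _ _ e0 b0 c0.
lra.
Qed.

(** One step of the dissipation argument: f and e stand for L_j - E_j and E_j,
    b for u_j, and c for Y_(j+1); the two values of the corrector are those at j
    and at j+1.  Rounding each coefficient down, which is allowed since the
    variables are nonnegative, gives [rational_cubic_ge]. *)
Lemma local_inequality (R : realFieldType) (q d0 g0 ga be f e b c : R) :
  0 <= q -> q ^+ 6 = 1 / 2 ->
  dec4 113 60 <= d0 -> dec4 666 40 <= g0 -> dec4 749 60 <= ga -> be <= dec4 138 80 ->
  0 <= f -> 0 <= e -> 0 <= b -> 0 <= c ->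
  b ^+ 3 / 200 <=
    d0 * b ^+ 3 + g0 / 2 * b ^+ 2 * c
    + ((ga - be - 4 * q ^+ 3) / 2 * b - be / 2 * (f + e)
       + 2 * q ^+ 3 * (1 - q ^+ 3) * e) * c ^+ 2
    + (f + e) * b ^+ 2
    + corrector f e (q * (b + c))
    - corrector (q ^+ 2 * (f + (1 - q ^+ 3) * e)) (q ^+ 2 * (q ^+ 3 * e + b)) c.
Proof.
move=> q0 q6 hd0 hg0 hga hbe f0 e0 b0 c0.
have [/andP[l1 u1] /andP[l2 u2] /andP[l3 u3] /andP[l4 u4]
  [/andP[l5 u5] /andP[l7 u7] /andP[l10 u10]]] := root_power_bounds q0 q6.
rewrite [leRHS](_ : _ =
    (17/50 - 17/50 * q ^+ 3) * (c ^+ 3) +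
    ((ga - be) / 2 - 13/25 * q ^+ 2 - 151/50 * q ^+ 3) * (b * c ^+ 2) +
    (g0 / 2 - 51/50 * q ^+ 3 - 67/20 * q ^+ 4) * (b ^+ 2 * c) +
    (d0 - 17/50 * q ^+ 3) * (b ^+ 3) +
    (- (be / 2) + 73/50 * q ^+ 2 + 2 * q ^+ 3 - 73/50 * q ^+ 5 - 2 * q ^+ 6)
      * (e * c ^+ 2) +
    (26/25 * q ^+ 2 - 23/10 * q ^+ 4 - 22/5 * q ^+ 7) * (e * b * c) +
    (1 + 13/25 * q ^+ 2) * (e * b ^+ 2) +
    (67/20 * q - 149/20 * q ^+ 4 + 63/5 * q ^+ 7 - 17/2 * q ^+ 10)
      * (e ^+ 2 * c) +
    (67/20 * q) * (e ^+ 2 * b) +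
    (- (be / 2)) * (f * c ^+ 2) +
    (- 47/25 * q ^+ 2 - 23/10 * q ^+ 4) * (f * b * c) +
    (1 - 47/50 * q ^+ 2) * (f * b ^+ 2) +
    (23/10 * q - 149/10 * q ^+ 4 + 63/5 * q ^+ 7) * (f * e * c) +
    (23/10 * q) * (f * e * b) +
    (149/20 * q - 149/20 * q ^+ 4) * (f ^+ 2 * c) +
    (149/20 * q) * (f ^+ 2 * b)); last by rewrite /corrector; field.
apply: le_trans (rational_cubic_ge f0 e0 b0 c0) _.
repeat (apply: lerD); apply: ler_wpM2r; rewrite ?mulr_ge0 ?exprn_ge0 //.
- by clear -u3; lra.
- by clear -hga hbe u2 u3; lra.
- by clear -hg0 u3 u4; lra.
- by clear -hd0 u3; lra.
- by clear -hbe l2 l3 u5 q6; lra.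
- by clear -l2 u4 u7; lra.
- by clear -l2; lra.
- by clear -l1 u4 l7 u10; lra.
- by clear -l1; lra.
- by clear -hbe; lra.
- by clear -u2 u4; lra.
- by clear -u2; lra.
- by clear -l1 u4 l7; lra.
- by clear -l1; lra.
- by clear -l1 u4; lra.
- by clear -l1; lra.
Qed.

(** * The energy of a finite sequence *)

Section PastSums.
Context {R : realFieldType}.
Variables (q : R) (v : nat -> R).

(** The weights include q^(2(j-i)), the decay common to the last two families of
    the energy; L, E and X are obtained from different c. *)
Definition past_sum (c : nat -> R) (j : nat) : R :=
  \sum_(0 <= i < j) c (j - i)%N * q ^+ (2 * (j - i)) * v i.

Lemma past_sum0 c : past_sum c 0 = 0.
Proof. by rewrite /past_sum big_geq. Qed.

Lemma past_sumS c j :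
  past_sum c j.+1 = q ^+ 2 * (past_sum (c \o succn) j + c 1%N * v j).
Proof.
rewrite /past_sum big_nat_recr //= mulrDr big_distrr /= subSnn.
congr (_ + _); last by rewrite muln1; ring.
apply: eq_big_nat => i /andP[_ ij]; rewrite subSn; last exact: ltnW.
by rewrite mulnS exprD; ring.
Qed.

Lemma eq_past_sum c c' j : (forall a, (0 < a)%N -> c a = c' a) ->
  past_sum c j = past_sum c' j.
Proof.
by move=> cc; apply: eq_big_nat => i /andP[_ ij]; rewrite cc // subn_gt0.
Qed.

Lemma past_sumD c c' j :
  past_sum (fun a => c a + c' a) j = past_sum c j + past_sum c' j.
Proof. by rewrite -big_split /=; apply: eq_bigr => i _; rewrite -!mulrDl. Qed.

Lemma past_sumZ x c j : past_sum (fun a => x * c a) j = x * past_sum c j.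
Proof. by rewrite big_distrr; apply: eq_bigr => i _ /=; rewrite !mulrA. Qed.

Lemma le_past_sum c c' j : 0 <= q -> (forall i, 0 <= v i) ->
  (forall a, (0 < a)%N -> c a <= c' a) -> past_sum c j <= past_sum c' j.
Proof.
move=> q0 v0 cc; apply: ler_sum_nat => i /andP[_ ij].
by rewrite -!mulrA ler_wpM2r ?mulr_ge0 ?exprn_ge0 // cc // subn_gt0.
Qed.

End PastSums.

Section FiniteEnergy.
Context {R : realFieldType}.
Variables (q d0 g0 ga be : R) (g h : nat -> R).
Hypotheses (q0 : 0 < q) (q6 : q ^+ 6 = 1 / 2).
Hypotheses (d0_ge : dec4 113 60 <= d0) (g0_ge : dec4 666 40 <= g0).
Hypotheses (ga_ge : dec4 749 60 <= ga) (be_le : be <= dec4 138 80).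
Let minorant (a : nat) : R := ga - be * a%:R - 4 * q ^+ (3 * a).
Hypothesis g_ge : forall a, (0 < a)%N -> minorant a <= g a.
Hypothesis h_ge : forall a, (0 < a)%N -> minorant a + 2 <= h a.
Variables (v : nat -> R) (n : nat).
Hypothesis v_ge0 : forall i, 0 <= v i.

(** This is Y_j; with the exponent k-j+1 the sum over k > j of q^(k-j) v_k
    occurring in the energy is [future_sum j.+1]. *)
Definition future_sum (j : nat) : R := \sum_(j <= k < n) q ^+ (k - j).+1 * v k.

Lemma future_sum_ge0 j : 0 <= future_sum j.
Proof. by apply: sumr_ge0 => k _; rewrite mulr_ge0 ?exprn_ge0 // ltW. Qed.

Lemma future_sum_end : future_sum n = 0.
Proof. by rewrite /future_sum big_geq. Qed.

Lemma future_sumS j : (j < n)%N -> future_sum j = q * (v j + future_sum j.+1).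
Proof.
move=> jn; rewrite /future_sum big_ltn // subnn expr1 mulrDr big_distrr /=.
congr (_ + _); apply: eq_big_nat => k /andP[jk _].
by rewrite mulrA -exprS subnSK.
Qed.

Let L := past_sum q v (fun=> 1).
Let E := past_sum q v (fun a => q ^+ (3 * a.-1)).
Let X := past_sum q v minorant.
Let Y := future_sum.

(* The second summand telescopes the X-part of the cost, the first one is
   chosen so that the remainder is nonnegative. *)
Let potential j :=
  corrector (L j - E j) (E j) (Y j) - X j * Y j ^+ 2 / (2 * q ^+ 2).

Let LS j : L j.+1 = q ^+ 2 * (L j + v j).
Proof. by rewrite /L past_sumS mul1r. Qed.

Let ES j : E j.+1 = q ^+ 2 * (q ^+ 3 * E j + v j).
Proof.
rewrite /E past_sumS /= mul1r -past_sumZ; congr (_ * (_ + _)).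
by apply: eq_past_sum => -[|a] //= _; rewrite mulnS exprD.
Qed.

Let XS j : X j.+1 = q ^+ 2 *
  (X j - be * L j + 4 * q ^+ 3 * (1 - q ^+ 3) * E j
   + (ga - be - 4 * q ^+ 3) * v j).
Proof.
rewrite /X past_sumS; congr (_ * (_ + _ * _)); last first.
  by rewrite /minorant muln1 mulr1.
rewrite -mulNr -past_sumZ -past_sumZ -!past_sumD.
apply: eq_past_sum => -[|a] // _.
by rewrite /minorant /= -[(a.+2)%:R]natr1 !mulnS !exprD; ring.
Qed.

Let E_ge0 j : 0 <= E j.
Proof.
elim: j => [|j IH]; first by rewrite /E past_sum0.
by rewrite ES mulr_ge0 ?addr_ge0 ?mulr_ge0 ?exprn_ge0 ?(ltW q0) //.
Qed.

Let LE_ge0 j : 0 <= L j - E j.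
Proof.
elim: j => [|j IH]; first by rewrite /E /L !past_sum0 subr0.
have -> : L j.+1 - E j.+1 = q ^+ 2 * ((L j - E j) + (1 - q ^+ 3) * E j).
  by rewrite LS ES; ring.
have q3 : 0 <= 1 - q ^+ 3.
  have : 0 <= q ^+ 3 by rewrite exprn_ge0 // ltW.
  have : (q ^+ 3) ^+ 2 = 1 / 2 by rewrite -exprM q6.
  by move: (q ^+ 3) => z; nra.
apply: mulr_ge0; first exact: exprn_ge0 (ltW q0).
by apply: addr_ge0 => //; exact: mulr_ge0.
Qed.

Let cost j := d0 * v j ^+ 3 + g0 / 2 * v j ^+ 2 * Y j.+1
  + v j * X j * (Y j.+1 + v j / 2) + L j * v j ^+ 2.

(* X_j cancels from the difference of potentials plus cost, so that only the
   variables of [local_inequality] remain. *)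
Let cost_ge j : (j < n)%N ->
  v j ^+ 3 / 200 + (potential j.+1 - potential j) <= cost j.
Proof.
move=> jn; have := local_inequality (ltW q0) q6 d0_ge g0_ge ga_ge be_le
  (LE_ge0 j) (E_ge0 j) (v_ge0 j) (future_sum_ge0 j.+1).
rewrite -lerBrDr => /le_trans; apply.
rewrite le_eqVlt; apply/orP; left; apply/eqP.
rewrite /cost /potential /Y -/L -/E (future_sumS jn) XS LS ES.
have -> : q ^+ 2 * (L j + v j) - q ^+ 2 * (q ^+ 3 * E j + v j) =
  q ^+ 2 * (L j - E j + (1 - q ^+ 3) * E j) by ring.
set c1 := corrector _ _ _; set c2 := corrector _ _ _.
by field; rewrite lt0r_neq0.
Qed.

(** Summing the dissipation inequality: the potential is 0 at n, where the
    future sum is empty, and at most 0 at 0, where the past sums are empty and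
    the corrector reduces to a negative multiple of Y_0^3. *)
Lemma finite_energy_ge :
  (\sum_(0 <= j < n) v j ^+ 3) / 200 <=
    d0 * (\sum_(0 <= j < n) v j ^+ 3)
    + g0 / 2 * (\sum_(0 <= j < n) v j ^+ 2 * future_sum j.+1)
    + 1 / 2 * (\sum_(0 <= j < n) past_sum q v h j * v j ^+ 2)
    + \sum_(0 <= j < n) past_sum q v g j * v j * future_sum j.+1.
Proof.
apply: (@le_trans _ _ (\sum_(0 <= j < n) cost j)); last first.
  rewrite !big_distrr -!big_split /=; apply: ler_sum_nat => j _.
  have Xg : X j <= past_sum q v g j by apply: le_past_sum => //; exact: ltW.
  have Xh : X j + 2 * L j <= past_sum q v h j.
    rewrite -past_sumZ -past_sumD; apply: le_past_sum => //; first exact: ltW.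
    by move=> a a0; rewrite mulr1 h_ge.
  have h1 : 0 <= (past_sum q v g j - X j) * (v j * Y j.+1).
    by rewrite !mulr_ge0 ?subr_ge0 // future_sum_ge0.
  have h2 : 0 <= (past_sum q v h j - (X j + 2 * L j)) * v j ^+ 2.
    by rewrite mulr_ge0 ?subr_ge0 ?exprn_ge0.
  rewrite /cost -/Y; lra.
apply: (@le_trans _ _ (\sum_(0 <= j < n)
    (v j ^+ 3 / 200 + (potential j.+1 - potential j)))); last first.
  by apply: ler_sum_nat => j /andP[_ jn]; exact: cost_ge.
rewrite big_split /= telescope_sumr // -big_distrl /= lerDl.
have -> : potential n = 0.
  by rewrite /potential /Y future_sum_end /corrector; ring.
rewrite sub0r oppr_ge0 /potential /L /E /X !past_sum0 /corrector.
have := exprn_ge0 3 (future_sum_ge0 0); rewrite -/Y; lra.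
Qed.

End FiniteEnergy.

(** * Sums over an exhausting sequence of finite sets *)

Section Exhaustion.
Context {R : realType} {T : choiceType}.
Variables (D : set T) (rank : T -> nat) (box : nat -> seq T).
Hypothesis box_uniq : forall N, uniq (box N).
Hypothesis box_mem : forall N x, x \in box N <-> D x /\ (rank x <= N)%N.

Let box_fsets N : fsets D [set` box N].
Proof. by split; [exact: finite_seq|move=> x /= /box_mem[]]. Qed.

Lemma box_sum_le_esum (a : T -> R) N : (forall x, 0 <= a x) ->
  ((\sum_(x <- box N) a x)%:E <= \esum_(x in D) (a x)%:E)%E.
Proof.
move=> a0; apply: esum_ge; exists [set` box N]; first exact: box_fsets.
by rewrite -sumEFin fsbig_seq.
Qed.

(** A finite subset of D lies in one box, since [rank] is bounded on it. *)
Lemma esum_box_le (a : T -> R) (M : R) : (forall x, 0 <= a x) ->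
  (forall N, \sum_(x <- box N) a x <= M) ->
  (\esum_(x in D) (a x)%:E <= M%:E)%E.
Proof.
move=> a0 aM; apply: ge_ereal_sup => _ [X [finX XD] <-].
have [N XN] : exists N, X `<=` [set` box N].
  have /finite_seqP[r Xr] := finX; move: XD; rewrite {}Xr {finX}.
  elim: r => [|x r IH] rD; first by exists 0%N.
  have [|N HN] := IH; first by move=> y yr; apply: rD; rewrite /= inE yr orbT.
  exists (maxn (rank x) N) => y /=; rewrite inE => /orP[/eqP->|yr].
    by apply/box_mem; rewrite leq_maxl; split=> //; apply: rD; rewrite /= mem_head.
  have /box_mem[Dy ry] : y \in box N by exact: HN.
  by apply/box_mem; split=> //; rewrite leq_max ry orbT.
apply: (@le_trans _ _ (\sum_(x <- box N) a x)%:E); last by rewrite lee_fin.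
rewrite -sumEFin (fsbig_seq _ _ (box_uniq N)); apply: lee_fsum_nneg_subset => //.
- exact/subsetP.
- by move=> t _; rewrite lee_fin.
Qed.

Lemma esum_box_fin_num (a : T -> R) (M : R) : (forall x, 0 <= a x) ->
  (forall N, \sum_(x <- box N) a x <= M) ->
  \esum_(x in D) (a x)%:E \is a fin_num.
Proof.
move=> a0 aM; rewrite fin_numElt (le_lt_trans (esum_box_le a0 aM)) ?ltry // andbT.
by rewrite (@lt_le_trans _ _ 0%E) ?ltNyr ?esum_ge0 // => x _; rewrite lee_fin.
Qed.

Lemma box_sum_cvg_ge0 (a : T -> R) (M : R) : (forall x, 0 <= a x) ->
  (forall N, \sum_(x <- box N) a x <= M) ->
  (\sum_(x <- box N) a x) @[N --> \oo] --> fine (\esum_(x in D) (a x)%:E).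
Proof.
move=> a0 aM; set S := fun N => \sum_(x <- box N) a x.
have Smono : nondecreasing_seq S.
  move=> N N' NN'; rewrite /S.
  have perm_box : perm_eq [seq x <- box N' | x \in box N] (box N).
    apply: uniq_perm; rewrite ?filter_uniq // => x; rewrite mem_filter.
    have [xN|//] := boolP (x \in box N); rewrite andTb.
    by apply/box_mem; have /box_mem[Dx rx] := xN; split=> //; exact: leq_trans NN'.
  rewrite [leRHS](bigID [in box N]) /=.
  rewrite -[in leRHS]big_filter (perm_big _ perm_box) /=.
  by rewrite lerDl sumr_ge0.
have Sub : has_ubound (range S) by exists M => _ [N _ <-]; exact: aM.
have Scvg := nondecreasing_is_cvgn Smono Sub.
suff -> : \esum_(x in D) (a x)%:E = (limn S)%:E by [].
apply/eqP; rewrite eq_le; apply/andP; split.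
  by apply: esum_box_le => // N; exact: nondecreasing_cvgn_le.
have Efin := esum_box_fin_num a0 aM.
rewrite -(fineK Efin) lee_fin; apply: limr_le => //; apply: nearW => N.
by rewrite -lee_fin fineK // box_sum_le_esum.
Qed.

(** Uniformly bounded sums of absolute values over the boxes give both
    summability and convergence; the signed case splits f into its positive and
    negative parts, as [usum] does. *)
Lemma box_sum_cvg (f : T -> R) (M : R) :
  (forall N, \sum_(x <- box N) `|f x| <= M) ->
  abs_summable D f /\ (\sum_(x <- box N) f x) @[N --> \oo] --> usum D f.
Proof.
move=> fM; split.
  rewrite /abs_summable /summable.
  apply: le_lt_trans (esum_box_le (fun x => normr_ge0 (f x)) fM) (ltry _).
pose fp x := Order.max (f x) 0; pose fn x := Order.max (- f x) 0.
have fp0 x : 0 <= fp x by rewrite /fp le_max lexx orbT.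
have fn0 x : 0 <= fn x by rewrite /fn le_max lexx orbT.
have fE x : f x = fp x - fn x.
  by rewrite /fp /fn; case: (lerP (f x) 0) => fx; case: (lerP (- f x) 0) => nfx; lra.
have fpM N : \sum_(x <- box N) fp x <= M.
  apply: le_trans (fM N); apply: ler_sum => x _.
  by rewrite /fp ge_max ler_norm normr_ge0.
have fnM N : \sum_(x <- box N) fn x <= M.
  apply: le_trans (fM N); apply: ler_sum => x _.
  by rewrite /fn ge_max -normrN ler_norm normr_ge0.
have cp := box_sum_cvg_ge0 fp0 fpM; have cn := box_sum_cvg_ge0 fn0 fnM.
have -> : usum D f =
    fine (\esum_(x in D) (fp x)%:E) - fine (\esum_(x in D) (fn x)%:E).
  rewrite /usum -fineB ?(esum_box_fin_num fp0 fpM) ?(esum_box_fin_num fn0 fnM) //.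
  congr (fine (_ - _)%E); apply: eq_esum => x _ /=.
    by rewrite funeposE /= /fp EFin_max.
  by rewrite funenegE /= /fn EFin_max.
have -> : (fun N => \sum_(x <- box N) f x) =
    (fun N => \sum_(x <- box N) fp x - \sum_(x <- box N) fn x).
  by apply/funext => N; rewrite -sumrB; apply: eq_bigr => x _.
exact: cvgB.
Qed.

End Exhaustion.

(** * Windows of integer sites *)

Section Windows.
Implicit Types (N i j k : nat).

(** The window [-N, N] is indexed by 0, ..., 2N, so that finite sums over it are
    sums over natural numbers. *)
Definition site N i : int := i%:Z - N%:Z.
Definition window N := index_iota 0 (2 * N).+1.

Lemma site_inj N : injective (site N).
Proof. by move=> i j; rewrite /site => ?; lia. Qed.

Lemma site_sub N i j : (i <= j)%N -> site N j - site N i = (j - i)%N%:Z.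
Proof. by rewrite /site => ?; lia. Qed.

Lemma siteP N (x : int) :
  (absz x <= N)%N -> exists2 i, (i < (2 * N).+1)%N & x = site N i.
Proof. by move=> xN; exists (absz (x + N%:Z)); rewrite /site; lia. Qed.

Lemma absz_site N i : (i < (2 * N).+1)%N -> (absz (site N i) <= N)%N.
Proof. by rewrite /site; lia. Qed.

Definition box1 N : seq int := [seq site N i | i <- window N].

(** Pairs j < k in the window, enumerated with the smaller member outermost:
    the inner sum is then a future sum.  The next two enumerations put the larger
    member of a pair and the middle member of a triple outermost, so that the
    inner sums are past sums, and for triples a past and a future sum. *)
Definition pairs_from_left N : seq (nat * nat) :=
  [seq (j, k) | j <- window N, k <- index_iota j.+1 (2 * N).+1].

Definition pairs_from_right N : seq (nat * nat) :=
  [seq (i, j) | j <- window N, i <- index_iota 0 j].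

Definition triples_from_middle N : seq (nat * nat * nat) :=
  [seq (p, k) | p <- pairs_from_right N, k <- index_iota p.2.+1 (2 * N).+1].

Definition site2 N (p : nat * nat) : int * int := (site N p.1, site N p.2).
Definition site3 N (p : nat * nat * nat) : int * int * int :=
  (site2 N p.1, site N p.2).

Lemma mem_pairs_from_left N p :
  (p \in pairs_from_left N) = (p.1 < p.2 < (2 * N).+1)%N.
Proof.
apply/allpairsPdep/idP => [[j [k [+ + ->]]]|]; rewrite ?mem_index_iota /=; first lia.
by case: p => j k /= jk; exists j, k; rewrite !mem_index_iota; split=> //; lia.
Qed.

Lemma mem_pairs_from_right N p :
  (p \in pairs_from_right N) = (p.1 < p.2 < (2 * N).+1)%N.
Proof.
apply/allpairsPdep/idP => [[j [i [+ + ->]]]|]; rewrite ?mem_index_iota /=; first lia.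
by case: p => i j /= ij; exists j, i; rewrite !mem_index_iota; split=> //; lia.
Qed.

Lemma mem_triples_from_middle N p :
  (p \in triples_from_middle N) =
    [&& p.1.1 < p.1.2, p.1.2 < p.2 & p.2 < (2 * N).+1]%N.
Proof.
apply/allpairsPdep/idP => [[a [k [+ + ->]]]|].
  by rewrite mem_pairs_from_right mem_index_iota /=; lia.
case: p => -[i j] k /= ijk; exists (i, j), k.
by rewrite mem_pairs_from_right mem_index_iota /=; split=> //; lia.
Qed.

Lemma uniq_pairs_from_left N : uniq (pairs_from_left N).
Proof.
apply: allpairs_uniq_dep => [|j _|]; rewrite ?iota_uniq //.
by move=> [a b] [c d] _ _ /= [-> ->].
Qed.

Lemma uniq_pairs_from_right N : uniq (pairs_from_right N).
Proof.
apply: allpairs_uniq_dep => [|j _|]; rewrite ?iota_uniq //.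
by move=> [a b] [c d] _ _ /= [-> ->].
Qed.

Lemma uniq_triples_from_middle N : uniq (triples_from_middle N).
Proof.
apply: allpairs_uniq_dep => [|j _|]; rewrite ?iota_uniq ?uniq_pairs_from_right //.
by move=> [a b] [c d] _ _ /= [-> ->].
Qed.

Definition rank2 (p : int * int) := maxn (absz p.1) (absz p.2).
Definition rank3 (p : int * int * int) := maxn (rank2 p.1) (absz p.2).

Lemma box1_mem N x : x \in box1 N <-> [set: int] x /\ (absz x <= N)%N.
Proof.
split=> [/mapP[i]|[_ /siteP[i iN ->]]].
  by rewrite mem_index_iota => iN ->; split=> //; exact: absz_site.
by rewrite map_f // mem_index_iota.
Qed.

Lemma site2_mem N (l : seq (nat * nat)) :
  (forall p, (p \in l) = (p.1 < p.2 < (2 * N).+1)%N) ->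
  forall x, x \in map (site2 N) l <-> pairs x /\ (rank2 x <= N)%N.
Proof.
move=> lE [x y]; split=> [/mapP[[i j]]|].
  rewrite lE /= => ijN [-> ->]; split; first by rewrite /pairs /= /site; lia.
  by rewrite /rank2 /= geq_max !absz_site //; lia.
rewrite /pairs /rank2 /= geq_max => -[xy /andP[/siteP[i iN xE] /siteP[j jN yE]]].
apply/mapP; exists (i, j); rewrite /site2 /= ?xE ?yE // lE /=.
by move: xy; rewrite xE yE /site; lia.
Qed.

Lemma site3_mem N x :
  x \in map (site3 N) (triples_from_middle N) <-> triples x /\ (rank3 x <= N)%N.
Proof.
case: x => -[x y] z; split=> [/mapP[[[i j] k]]|].
  rewrite mem_triples_from_middle /= => ijN [-> -> ->]; split.
    by rewrite /triples /= /site; lia.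
  by rewrite /rank3 /rank2 /= !geq_max !absz_site //; lia.
rewrite /triples /rank3 /rank2 /= !geq_max.
move=> -[xyz /andP[/andP[/siteP[i iN xE] /siteP[j jN yE]] /siteP[k kN zE]]].
apply/mapP; exists (i, j, k); rewrite /site3 /site2 /= ?xE ?yE ?zE //.
by move: xyz; rewrite mem_triples_from_middle xE yE zE /site /=; lia.
Qed.

Lemma site2_inj N : injective (site2 N).
Proof. by move=> [a b] [c d] [/site_inj -> /site_inj ->]. Qed.

Lemma site3_inj N : injective (site3 N).
Proof. by move=> [[a b] c] [[d e] f] [/site_inj -> /site_inj -> /site_inj ->]. Qed.

End Windows.

(** * Cubic bounds for geometric sums *)

Section CubicBounds.
Context {R : realFieldType}.
Implicit Types a b v : nat -> R.

(** Past and future sums satisfy b_j = q (v_j + a_j) with a and b shifts of each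
    other.  From (d + c)^3 <= (4/3) c^3 + 60 d^3 and q^3 * 4/3 < 1, the sum of
    a_j^3 is absorbed on the left. *)
Lemma sum_cubes_le_of_recursion (q : R) a b v n : 0 <= q <= 9 / 10 ->
  (forall j, 0 <= a j) -> (forall j, 0 <= v j) ->
  (forall j, (j < n)%N -> b j = q * (v j + a j)) ->
  \sum_(0 <= j < n) a j ^+ 3 <= \sum_(0 <= j < n) b j ^+ 3 ->
  \sum_(0 <= j < n) a j ^+ 3 <= 2000 * \sum_(0 <= j < n) v j ^+ 3.
Proof.
move=> /andP[q0 q1] a0 v0 ba ab.
have q3 : q ^+ 3 <= 729 / 1000.
  have -> : 729 / 1000 = (9 / 10) ^+ 3 :> R by field.
  by rewrite lerXn2r ?nnegrE //; lra.
have q30 : 0 <= q ^+ 3 by rewrite exprn_ge0.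
have step j : (j < n)%N ->
    b j ^+ 3 <= 972 / 1000 * a j ^+ 3 + 44 * v j ^+ 3.
  move=> jn; rewrite ba // exprMn; move: (a j) (v j) (a0 j) (v0 j) => c d c0 d0.
  have h : 4 / 3 * c ^+ 3 + 60 * d ^+ 3 - (d + c) ^+ 3 =
     (c - 65 / 10 * d) ^+ 2 * (c / 3 + 4 / 3 * d)
     + c * d ^+ 2 / 4 + (59 - 169 / 3) * d ^+ 3 by field.
  have : 0 <= 4 / 3 * c ^+ 3 + 60 * d ^+ 3 - (d + c) ^+ 3.
    (* For d = 1, c = 6.5 is close to the minimum of c^3/3 - 3c^2 - 3c. *)
    have e1 : 0 <= (c - 65 / 10 * d) ^+ 2 * (c / 3 + 4 / 3 * d).
      by apply: mulr_ge0; [exact: sqr_ge0|lra].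
    have e2 : 0 <= c * d ^+ 2 by apply: mulr_ge0; [|exact: sqr_ge0].
    have e3 : 0 <= d ^+ 3 by exact: exprn_ge0.
    by rewrite h; clear -e1 e2 e3; lra.
  have c3 := exprn_ge0 3 c0; have d3 := exprn_ge0 3 d0.
  have s3 : 0 <= (d + c) ^+ 3 by rewrite exprn_ge0 // addr_ge0.
  move=> k; apply: (@le_trans _ _ (729 / 1000 * (d + c) ^+ 3)).
    by rewrite ler_wpM2r.
  lra.
have : \sum_(0 <= j < n) b j ^+ 3 <=
    972 / 1000 * (\sum_(0 <= j < n) a j ^+ 3) + 44 * (\sum_(0 <= j < n) v j ^+ 3).
  rewrite !big_distrr -big_split /=; apply: ler_sum_nat => j /andP[_ jn].
  exact: step.
have : 0 <= \sum_(0 <= j < n) v j ^+ 3 by apply: sumr_ge0 => j _; rewrite exprn_ge0.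
lra.
Qed.

Lemma mul3_le_cubes (x y z : R) : 0 <= x -> 0 <= y -> 0 <= z ->
  x * y * z <= x ^+ 3 + y ^+ 3 + z ^+ 3.
Proof.
move=> x0 y0 z0.
have h1 : x ^+ 3 + y ^+ 3 + z ^+ 3 - 3 * (x * y * z) =
  (x + y + z) * ((x - y) ^+ 2 + (y - z) ^+ 2 + (z - x) ^+ 2) / 2 by field.
have h2 : 0 <= (x + y + z) * ((x - y) ^+ 2 + (y - z) ^+ 2 + (z - x) ^+ 2) / 2.
  by apply: mulr_ge0; [apply: mulr_ge0; rewrite !addr_ge0 ?sqr_ge0|].
have h3 : 0 <= x * y * z by rewrite !mulr_ge0.
lra.
Qed.

End CubicBounds.

(** * The energy restricted to a window *)

Section WindowSums.
Context {R : realType}.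
Variables (u : int -> R) (N : nat).
Hypothesis u_ge0 : forall j, 0 <= u j.
Let n := (2 * N).+1.
Let v i := u (site N i).
Let Y := future_sum (q : R) v n.

Let v_ge0 i : 0 <= v i. Proof. exact: u_ge0. Qed.

Lemma sqleft_termE j k : (j < k)%N ->
  sqleft_term u (site2 N (j, k)) = v j ^+ 2 * (q ^+ (k - j.+1).+1 * v k).
Proof.
move=> jk; rewrite /sqleft_term /site2 /= site_sub ?(ltnW jk) //.
by rewrite -exprnP subnSK // /v; ring.
Qed.

Lemma sqright_termE i j : (i < j)%N ->
  sqright_term u (site2 N (i, j)) =
    h (j - i) * q ^+ (2 * (j - i)) * v i * v j ^+ 2.
Proof.
by move=> ij; rewrite /sqright_term /site2 /= site_sub ?(ltnW ij).
Qed.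

Lemma triple_termE i j k : (i < j < k)%N ->
  triple_term u (site3 N (i, j, k)) =
    g (j - i) * q ^+ (2 * (j - i)) * v i * v j * (q ^+ (k - j.+1).+1 * v k).
Proof.
move=> /andP[ij jk]; rewrite /triple_term /site3 /site2 /=.
rewrite !site_sub ?(ltnW ij) //; last lia.
rewrite -PoszD -exprnP.
have -> : ((j - i) + (k - i) = 2 * (j - i) + (k - j.+1).+1)%N by lia.
by rewrite exprD absz_nat /v; ring.
Qed.

Lemma sum_box1 (f : int -> R) :
  \sum_(x <- box1 N) f x = \sum_(0 <= j < n) f (site N j).
Proof. by rewrite big_map. Qed.

Lemma sum_pairs_from_left (f : int * int -> R) :
  \sum_(p <- map (site2 N) (pairs_from_left N)) f p =
  \sum_(0 <= j < n) \sum_(j.+1 <= k < n) f (site2 N (j, k)).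
Proof. by rewrite big_map big_allpairs_dep. Qed.

Lemma sum_pairs_from_right (f : int * int -> R) :
  \sum_(p <- map (site2 N) (pairs_from_right N)) f p =
  \sum_(0 <= j < n) \sum_(0 <= i < j) f (site2 N (i, j)).
Proof. by rewrite big_map big_allpairs_dep. Qed.

Lemma sum_triples_from_middle (f : int * int * int -> R) :
  \sum_(p <- map (site3 N) (triples_from_middle N)) f p =
  \sum_(0 <= j < n) \sum_(0 <= i < j) \sum_(j.+1 <= k < n) f (site3 N (i, j, k)).
Proof. by rewrite big_map !big_allpairs_dep. Qed.

Lemma sum_sqleft :
  \sum_(p <- map (site2 N) (pairs_from_left N)) sqleft_term u p =
  \sum_(0 <= j < n) v j ^+ 2 * Y j.+1.
Proof.
rewrite sum_pairs_from_left; apply: eq_big_nat => j _.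
by rewrite big_distrr; apply: eq_big_nat => k /andP[jk _]; rewrite sqleft_termE.
Qed.

Lemma sum_sqright :
  \sum_(p <- map (site2 N) (pairs_from_right N)) sqright_term u p =
  \sum_(0 <= j < n) past_sum q v h j * v j ^+ 2.
Proof.
rewrite sum_pairs_from_right; apply: eq_big_nat => j _.
by rewrite big_distrl; apply: eq_big_nat => i /andP[_ ij]; rewrite sqright_termE.
Qed.

Lemma sum_triple :
  \sum_(p <- map (site3 N) (triples_from_middle N)) triple_term u p =
  \sum_(0 <= j < n) past_sum q v g j * v j * Y j.+1.
Proof.
rewrite sum_triples_from_middle; apply: eq_big_nat => j _.
rewrite !big_distrl; apply: eq_big_nat => i /andP[_ ij].
rewrite big_distrr; apply: eq_big_nat => k /andP[jk _].
by rewrite triple_termE // ij.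
Qed.

(* Without the common weight q^(2(j-i)), this is the sum of q^(j-i) v_i; it
   dominates the past sums of |g| and |h|. *)
Let P := past_sum q v (fun a => q ^- a : R).

Let q0 : 0 < q :> R. Proof. exact: q_gt0. Qed.
Let q01 : 0 <= (q : R) <= 9 / 10. Proof. by rewrite ltW ?q_le. Qed.

Let P_ge0 j : 0 <= P j.
Proof.
by apply: sumr_ge0 => i _; rewrite !mulr_ge0 ?invr_ge0 ?exprn_ge0 // ltW.
Qed.

Let PS j : P j.+1 = q * (v j + P j).
Proof.
rewrite /P past_sumS expr1 /=.
rewrite (eq_past_sum _ _ (c' := fun a => q^-1 * q ^- a)) => [|a _]; last first.
  by rewrite /= exprS invfM.
by rewrite past_sumZ; field; rewrite lt0r_neq0.
Qed.

Let Y_ge0 j : 0 <= Y j. Proof. exact: future_sum_ge0. Qed.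

Let V := \sum_(0 <= j < n) v j ^+ 3.

Let cubes_Y : \sum_(0 <= j < n) Y j.+1 ^+ 3 <= 2000 * V.
Proof.
apply: (@sum_cubes_le_of_recursion _ q _ (fun j => Y j)) => // [j jn|].
  exact: future_sumS.
rewrite -(big_add1 _ _ 0 n.+1 predT (fun j => Y j ^+ 3)) big_nat_recr //=.
rewrite [leRHS]big_ltn // (_ : Y n = 0) ?expr0n ?addr0 ?lerDr ?exprn_ge0 //.
exact: future_sum_end.
Qed.

Let cubes_P : \sum_(0 <= j < n) P j ^+ 3 <= 2000 * V.
Proof.
apply: (@sum_cubes_le_of_recursion _ q _ (fun j => P j.+1)) => //.
rewrite -(big_add1 _ _ 0 n.+1 predT (fun j => P j ^+ 3)) [leRHS]big_nat_recr //=.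
by rewrite big_ltn // /P past_sum0 expr0n add0r lerDl exprn_ge0 // P_ge0.
Qed.

Let V_ge0 : 0 <= V.
Proof. by apply: sumr_ge0 => j _; rewrite exprn_ge0. Qed.

Lemma abs_sum_sqleft :
  \sum_(p <- map (site2 N) (pairs_from_left N)) `|sqleft_term u p| <= 5000 * V.
Proof.
have -> : \sum_(p <- map (site2 N) (pairs_from_left N)) `|sqleft_term u p| =
    \sum_(0 <= j < n) v j ^+ 2 * Y j.+1.
  rewrite -sum_sqleft; apply: eq_bigr => -[j k] _; rewrite ger0_norm //.
  by rewrite /sqleft_term !mulr_ge0 ?exprn_ge0 ?exprz_ge0 // ltW.
apply: (@le_trans _ _ (\sum_(0 <= j < n) (2 * v j ^+ 3 + Y j.+1 ^+ 3))).
  apply: ler_sum_nat => j _.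
  by have := mul3_le_cubes (v_ge0 j) (v_ge0 j) (Y_ge0 j.+1); lra.
have := V_ge0; have := cubes_Y; rewrite big_split -big_distrr /= -/V; lra.
Qed.

Let abs_past (c : nat -> R) j :
  (forall a, (0 < a)%N -> `|c a| * q ^+ a <= 60) ->
  past_sum q v (fun a => `|c a|) j <= 60 * P j.
Proof.
move=> cq; rewrite /P -past_sumZ; apply: le_past_sum => //; first exact: ltW.
by move=> a a0; rewrite ler_pdivlMr ?exprn_gt0 // cq.
Qed.

Lemma abs_sum_sqright :
  \sum_(p <- map (site2 N) (pairs_from_right N)) `|sqright_term u p|
  <= 60 * (5000 * V).
Proof.
have -> : \sum_(p <- map (site2 N) (pairs_from_right N)) `|sqright_term u p| =
    \sum_(0 <= j < n) past_sum q v (fun a => `|h a : R|) j * v j ^+ 2.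
  rewrite sum_pairs_from_right; apply: eq_big_nat => j _.
  rewrite big_distrl; apply: eq_big_nat => i /andP[_ ij]; rewrite sqright_termE //.
  rewrite !normrM !normrX (ger0_norm (ltW q0)).
  by rewrite (ger0_norm (v_ge0 i)) (ger0_norm (v_ge0 j)).
apply: (@le_trans _ _ (\sum_(0 <= j < n) 60 * (2 * v j ^+ 3 + P j ^+ 3))).
  apply: ler_sum_nat => j _.
  have := mul3_le_cubes (P_ge0 j) (v_ge0 j) (v_ge0 j).
  have : past_sum q v (fun a => `|h a : R|) j * v j ^+ 2 <= 60 * P j * v j ^+ 2.
    rewrite ler_wpM2r ?exprn_ge0 //; apply: abs_past => a a0.
    by have [] := @coefficients_growth R a a0.
  lra.
have := V_ge0; have := cubes_P.
by rewrite -big_distrr big_split -big_distrr /= -/V; lra.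
Qed.

Lemma abs_sum_triple :
  \sum_(p <- map (site3 N) (triples_from_middle N)) `|triple_term u p|
  <= 60 * (5000 * V).
Proof.
have -> : \sum_(p <- map (site3 N) (triples_from_middle N)) `|triple_term u p| =
    \sum_(0 <= j < n) past_sum q v (fun a => `|g a : R|) j * v j * Y j.+1.
  rewrite sum_triples_from_middle; apply: eq_big_nat => j _.
  rewrite !big_distrl; apply: eq_big_nat => i /andP[_ ij].
  rewrite big_distrr; apply: eq_big_nat => k /andP[jk _].
  rewrite triple_termE ?ij //.
  rewrite !normrM !normrX (ger0_norm (ltW q0)).
  by rewrite (ger0_norm (v_ge0 i)) (ger0_norm (v_ge0 j)) (ger0_norm (v_ge0 k)).
apply: (@le_trans _ _ (\sum_(0 <= j < n) 60 * (P j ^+ 3 + v j ^+ 3 + Y j.+1 ^+ 3))).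
  apply: ler_sum_nat => j _.
  have := mul3_le_cubes (P_ge0 j) (v_ge0 j) (Y_ge0 j.+1).
  have : past_sum q v (fun a => `|g a : R|) j * (v j * Y j.+1)
      <= 60 * P j * (v j * Y j.+1).
    rewrite ler_wpM2r ?mulr_ge0 //; apply: abs_past => a a0.
    by have [] := @coefficients_growth R a a0.
  lra.
have := V_ge0; have := cubes_P; have := cubes_Y.
by rewrite -big_distrr !big_split /= -/V; lra.
Qed.

Lemma window_energy_ge :
  V / 200 <=
    d0 * (\sum_(x <- box1 N) cube_term u x)
    + g0 / 2 * (\sum_(p <- map (site2 N) (pairs_from_left N)) sqleft_term u p)
    + 1 / 2 * (\sum_(p <- map (site2 N) (pairs_from_right N)) sqright_term u p)
    + \sum_(p <- map (site3 N) (triples_from_middle N)) triple_term u p.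
Proof.
rewrite sum_sqleft sum_sqright sum_triple sum_box1.
apply: (@finite_energy_ge R q d0 g0 (4 + 2 * pi - 4 * ln 2) (2 * ln 2) g h) => //.
- exact: q_pow6.
- exact: d0_ge.
- exact: g0_ge.
- exact: offset_ge.
- exact: slope_le.
- by move=> a a0; have /andP[] := @Ginf_pow2 R a a0.
- by move=> a a0; have /andP[] := @Grep_pow2 R a a0.
Qed.

End WindowSums.

(** * Passage to the limit *)

Theorem theorem3p32 (R : realType) (u : int -> R)
    (u_ell3 : ell3 u) (u_ge0 : forall j : int, 0 <= u j) :
  energy_abs_cvg u /\ 0 <= energy u /\ (u <> (fun=> 0) -> 0 < energy u).
Proof.
have box1_uniq N : uniq (box1 N).
  by rewrite map_inj_uniq ?iota_uniq //; exact: site_inj.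
have boxl_uniq N : uniq (map (site2 N) (pairs_from_left N)).
  by rewrite map_inj_uniq ?uniq_pairs_from_left //; exact: site2_inj.
have boxr_uniq N : uniq (map (site2 N) (pairs_from_right N)).
  by rewrite map_inj_uniq ?uniq_pairs_from_right //; exact: site2_inj.
have box3_uniq N : uniq (map (site3 N) (triples_from_middle N)).
  by rewrite map_inj_uniq ?uniq_triples_from_middle //; exact: site3_inj.
have boxl_mem N := site2_mem (mem_pairs_from_left N).
have boxr_mem N := site2_mem (mem_pairs_from_right N).
pose V N := \sum_(0 <= j < (2 * N).+1) u (site N j) ^+ 3.
have [M VM] : exists M, forall N, V N <= M.
  exists (fine (\esum_(x in [set: int]) (`|u x| ^+ 3)%:E)) => N.
  have fin : \esum_(x in [set: int]) (`|u x| ^+ 3)%:E \is a fin_num.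
    have := u_ell3; rewrite /ell3 /abs_summable summableE.
    by under eq_esum do rewrite /= ger0_norm ?exprn_ge0 //.
  rewrite -lee_fin fineK //.
  apply: le_trans (box_sum_le_esum box1_uniq box1_mem N _); last first.
    by move=> x; rewrite exprn_ge0.
  by rewrite sum_box1 lee_fin; apply: ler_sum => j _; rewrite ger0_norm.
have [s1 c1] : abs_summable [set: int] (cube_term u) /\
    \sum_(x <- box1 N) cube_term u x @[N --> \oo] --> usum [set: int] (cube_term u).
  apply: (box_sum_cvg box1_uniq box1_mem (M := M)) => N.
  rewrite sum_box1; apply: le_trans (VM N); apply: ler_sum => j _.
  by rewrite ger0_norm // exprn_ge0.
have [s2 c2] : abs_summable pairs (sqleft_term u) /\
    \sum_(p <- map (site2 N) (pairs_from_left N)) sqleft_term u p @[N --> \oo] -->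
    usum pairs (sqleft_term u).
  apply: (box_sum_cvg boxl_uniq boxl_mem (M := 5000 * M)) => N.
  apply: le_trans (abs_sum_sqleft N u_ge0) _.
  by apply: ler_wpM2l; [exact: ler0n|exact: VM].
have [s3 c3] : abs_summable pairs (sqright_term u) /\
    \sum_(p <- map (site2 N) (pairs_from_right N)) sqright_term u p @[N --> \oo] -->
    usum pairs (sqright_term u).
  apply: (box_sum_cvg boxr_uniq boxr_mem (M := 60 * (5000 * M))) => N.
  apply: le_trans (abs_sum_sqright N u_ge0) _.
  by do 2!(apply: ler_wpM2l; first exact: ler0n); exact: VM.
have [s4 c4] : abs_summable triples (triple_term u) /\
    \sum_(p <- map (site3 N) (triples_from_middle N)) triple_term u p @[N --> \oo]
    --> usum triples (triple_term u).
  apply: (box_sum_cvg box3_uniq site3_mem (M := 60 * (5000 * M))) => N.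
  apply: le_trans (abs_sum_triple N u_ge0) _.
  by do 2!(apply: ler_wpM2l; first exact: ler0n); exact: VM.
(* A single term of the sum of cubes is kept; it gives strict positivity. *)
have lower x : u x ^+ 3 / 200 <= energy u.
  pose windowed N := d0 * (\sum_(x <- box1 N) cube_term u x)
    + g0 / 2 * (\sum_(p <- map (site2 N) (pairs_from_left N)) sqleft_term u p)
    + 1 / 2 * (\sum_(p <- map (site2 N) (pairs_from_right N)) sqright_term u p)
    + \sum_(p <- map (site3 N) (triples_from_middle N)) triple_term u p.
  have cE : windowed N @[N --> \oo] --> energy u.
    by apply: cvgD c4; apply: cvgD; [apply: cvgD|]; apply: cvgMl_tmp.
  apply: (cvgr_to_ge cE); near=> N.
  apply: le_trans (window_energy_ge N u_ge0).
  have [i iN ->] : exists2 i, (i < (2 * N).+1)%N & x = site N i.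
    by apply: siteP; near: N; exact: nbhs_infty_ge.
  rewrite ler_pM2r ?invr_gt0 // (bigD1_seq i) ?mem_index_iota ?iota_uniq //= lerDl.
  by rewrite sumr_ge0 // => j _; rewrite exprn_ge0.
split; [by split|split].
  by apply: le_trans (lower 0); rewrite divr_ge0 ?exprn_ge0.
move=> u0; have [x ux] : exists x, u x != 0.
  apply: contrapT => nu; apply: u0; apply/funext => x.
  by apply/eqP/negPn/negP => ux; apply: nu; exists x.
apply: lt_le_trans (lower x).
by rewrite divr_gt0 // exprn_gt0 // lt_neqAle eq_sym ux u_ge0.
Unshelve. all: by end_near. Qed.
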